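(* For real $\alpha$ with $|\alpha|<1$ and every integer $n\ge2$, $$\rho_n(\alpha)=\frac{(-1)^n\,n!}{4^n}\sum_{w}4^{\ell(w)}\,\mathrm{Li}_w(\alpha^2),$$ where the sum is over all finite index tuples $w=(2,a_2,a_3,\ldots,a_{\ell(w)})$ with first entry $2$, all further entries $a_2,a_3,\ldots\in\{1,2\}$, and $|w|=n$.
   Context: For real $\alpha$ and integer $n\ge0$, $\rho_n(\alpha)=\frac1{2\pi}\int_{-\pi}^{\pi}\left(\mathrm{Re}\,\log(1-\alpha e^{i\omega})\right)^n d\omega$, where $\mathrm{Re}\log(z)=\log|z|$. For a tuple $w=(a_1,\ldots,a_k)$ of positive integers, $\ell(w)=k$ is its length, $|w|=a_1+\cdots+a_k$ its weight, and $\mathrm{Li}_w(z)=\mathrm{Li}_{a_1,\ldots,a_k}(z)=\sum_{n_1>\cdots>n_k>0}\frac{z^{n_1}}{n_1^{a_1}\cdots n_k^{a_k}}$ is the generalized polylogarithm. *)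

(* Defs.v *)
(* Stdlib reals with Coquelicot. *)
From Stdlib Require Import Reals List Lia.
From Coquelicot Require Import Coquelicot.
Import ListNotations.
Open Scope R_scope.

Definition expi (omega : R) : C := (cos omega, sin omega).

(* Only the real part of the logarithm is used, and it does not depend on the
   branch.  At [z = 0] the value is Stdlib's default [ln 0 = 0]. *)
Definition Re_log (z : C) : R := ln (Cmod z).

(* [RInt] is the Riemann integral.  For [|alpha| <> 1] the integrand is
   continuous; for [|alpha| = 1] the integrand is unbounded for [n >= 1], the
   integral is improper, and this definition is not meaningful. *)
Definition rho (n : nat) (alpha : R) : R :=
  / (2 * PI) *
  RInt (fun omega => Re_log (1 - alpha * expi omega)%C ^ n) (- PI) PI.

(* [nested_sum [b_1; ...; b_j] N] is the sum over [N > m_1 > ... > m_j > 0] of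
   [1 / (m_1 ^ b_1 * ... * m_j ^ b_j)]; it is 1 for the empty tuple. *)
Fixpoint nested_sum (w : list nat) (N : nat) : R :=
  match w with
  | [] => 1
  | b :: w' =>
      sum_n_m (fun m => / INR m ^ b * nested_sum w' m) 1 (pred N)
  end.

(* The outermost index is [n_1 = S m], so that it starts at 1.  The series
   converges absolutely for [|z| < 1]; the value at the empty tuple is the
   usual convention. *)
Definition Li (w : list nat) (z : R) : R :=
  match w with
  | [] => 1
  | a :: w' => Series (fun m => z ^ S m / INR (S m) ^ a * nested_sum w' (S m))
  end.

Definition weight (w : list nat) : nat := list_sum w.

Definition admissible (n : nat) (w : list nat) : Prop :=
  exists w' : list nat,
    w = 2%nat :: w' /\
    List.Forall (fun a => a = 1%nat \/ a = 2%nat) w' /\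
    weight w = n.

Fixpoint words12 (n : nat) : list (list nat) :=
  match n with
  | O => [[]]
  | S n' =>
      map (cons 1%nat) (words12 n') ++
      match n' with
      | O => []
      | S n'' => map (cons 2%nat) (words12 n'')
      end
  end.

(* By [In_indices] and [NoDup_indices] below, each admissible tuple occurs
   exactly once. *)
Definition indices (n : nat) : list (list nat) :=
  match n with
  | S (S m) => map (cons 2%nat) (words12 m)
  | _ => []
  end.

Definition sum_over (l : list (list nat)) (f : list nat -> R) : R :=
  fold_right Rplus 0 (map f l).

Lemma In_words12 (w : list nat) : forall n : nat,
  In w (words12 n) <->
  List.Forall (fun a => a = 1%nat \/ a = 2%nat) w /\ weight w = n.
Proof.
  unfold weight; induction w as [|a w IH]; intros n.
  - split.
    + destruct n as [|[|n]]; simpl; [auto| |].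
      * intros [H|[]]; discriminate.
      * intros H; apply in_app_iff in H as [H|H].
        -- apply in_map_iff in H as [x [H _]]; discriminate.
        -- apply in_map_iff in H as [x [H _]]; discriminate.
    + intros [_ <-]; simpl; auto.
  - split.
    + destruct n as [|n]; simpl.
      * intros [H|[]]; discriminate.
      * intros H; apply in_app_iff in H as [H|H].
        -- apply in_map_iff in H as [x [E H]]; injection E as <- <-.
           apply IH in H as [H1 H2]; split; [constructor; auto|lia].
        -- destruct n as [|n]; [destruct H|].
           apply in_map_iff in H as [x [E H]]; injection E as <- <-.
           apply IH in H as [H1 H2]; split; [constructor; auto|lia].
    + intros [H <-]; inversion H as [|? ? [->| ->] Hw]; subst; simpl;
        apply in_app_iff; [left|right];
        apply in_map_iff; exists w; split; auto; apply IH; auto.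
Qed.

Lemma In_indices (n : nat) (w : list nat) :
  In w (indices n) <-> admissible n w.
Proof.
  unfold admissible; split.
  - destruct n as [|[|n]]; simpl; [intros []|intros []|].
    intros H; apply in_map_iff in H as [x [<- H]].
    apply In_words12 in H as [H1 H2]; exists x; unfold weight in *; simpl; auto.
  - intros [x [-> [H <-]]]; simpl.
    apply in_map_iff; exists x; split; auto; apply In_words12; auto.
Qed.

Lemma NoDup_map_cons (a : nat) (l : list (list nat)) :
  NoDup l -> NoDup (map (cons a) l).
Proof.
  intros H; apply NoDup_map_NoDup_ForallPairs; auto.
  intros x y _ _ E; injection E; auto.
Qed.

Lemma NoDup_words12 (n : nat) : NoDup (words12 n).
Proof.
  enough (H : NoDup (words12 n) /\ NoDup (words12 (S n))) by apply H.
  induction n as [|n [IH1 IH2]].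
  - split; repeat constructor; intros [].
  - split; auto.
    change (words12 (S (S n))) with
      (map (cons 1%nat) (words12 (S n)) ++ map (cons 2%nat) (words12 n)).
    apply NoDup_app; try (apply NoDup_map_cons; assumption).
    intros x H1 H2.
    apply in_map_iff in H1 as [y [<- _]].
    apply in_map_iff in H2 as [z [E _]]; discriminate.
Qed.

Lemma NoDup_indices (n : nat) : NoDup (indices n).
Proof.
  destruct n as [|[|n]]; simpl; try constructor.
  apply NoDup_map_cons, NoDup_words12.
Qed.

(* Main.v *)
(** The function [L = log |1 - a e^{it}|] is harmonic, and [|grad L|^2] is explicit,
    so with [theta = a d/da] the powers of [L] satisfy
      [(1 - a^2) theta^2 L^n + 2 n a^2 theta L^(n-1) - n (n-1) a^2 L^(n-2)
         = - (1 - a^2) (d/dt)^2 L^n].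
    Integrating over a period kills the right-hand side and leaves an ordinary
    differential equation for [rho_n] in terms of [rho_(n-1)] and [rho_(n-2)].
    The right-hand side of the theorem is a power series in [a^2]; splitting a
    word at its first letter gives a recurrence for its coefficients which says
    that it satisfies the same equation.  Both sides are regular at [a = 0] and
    have the same value there, hence they agree, by induction on [n]. *)

Require Import Defs.
From Stdlib Require Import Reals List Factorial Arith Lra Lia.
From Coquelicot Require Import Coquelicot.
Open Scope R_scope.

(** * The logarithmic kernel and its partial derivatives *)

(* [|1 - a e^{it}|^2]; the suffixes [_a] and [_t] below mark partial derivatives. *)
Definition qf (a t : R) : R := 1 - 2 * a * cos t + a ^ 2.
Definition Lf (a t : R) : R := ln (qf a t) / 2.
Definition Lf_a (a t : R) : R := (a - cos t) / qf a t.
Definition Lf_aa (a t : R) : R := / qf a t - 2 * (a - cos t) ^ 2 / qf a t ^ 2.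
Definition Lf_t (a t : R) : R := a * sin t / qf a t.
Definition Lf_tt (a t : R) : R :=
  a * cos t / qf a t - 2 * (a * sin t) ^ 2 / qf a t ^ 2.

(* The first two derivatives of [x ^ n]; for small [n] the truncated [pred] is
   harmless because of the factor [INR n]. *)
Definition pow_d1 (n : nat) (x : R) : R := INR n * x ^ pred n.
Definition pow_d2 (n : nat) (x : R) : R := INR n * pow_d1 (pred n) x.

(** Since [cos t] lies in [[-1, 1]], the quadratic is at least [(1 - a)^2] or [(1 + a)^2], according
    to the sign of [a]. *)
Lemma qf_pos (a t : R) : Rabs a < 1 -> 0 < qf a t.
Proof.
  intros H; unfold qf.
  apply Rabs_def2 in H.
  assert (Hc := COS_bound t).
  destruct (Rle_dec 0 a).
  - assert (0 < (1 - a) ^ 2) by (apply pow_lt; lra); nra.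
  - assert (0 < (1 + a) ^ 2) by (apply pow_lt; lra); nra.
Qed.

Lemma Re_log_Lf (a t : R) :
  Rabs a < 1 -> Re_log (1 - a * expi t)%C = Lf a t.
Proof.
  intros H; unfold Re_log, Lf, Cmod, expi; simpl fst; simpl snd.
  replace (_ ^ 2 + _ ^ 2) with (qf a t).
  - assert (Hq := qf_pos a t H).
    (* Writing [qf] as the product of two equal roots makes [ln (sqrt q)] half of [ln q]. *)
    rewrite <- (sqrt_sqrt (qf a t)) at 2 by lra.
    rewrite ln_mult by (apply sqrt_lt_R0; auto).
    field.
  - unfold qf; generalize (sin2_cos2 t); unfold Rsqr; intros E.
    simpl. nra.
Qed.

Lemma is_derive_pow_comp (n : nat) (f : R -> R) (x l : R) :
  is_derive f x l -> is_derive (fun u => f u ^ n) x (pow_d1 n (f x) * l).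
Proof.
  intros H; unfold pow_d1.
  evar_last; [apply (is_derive_pow f n x l H)|].
  ring.
Qed.

Lemma is_derive_pow_d1_comp (n : nat) (f : R -> R) (x l : R) :
  is_derive f x l -> is_derive (fun u => pow_d1 n (f u)) x (pow_d2 n (f x) * l).
Proof.
  intros H; unfold pow_d2; unfold pow_d1 at 1.
  evar_last;
    [apply (is_derive_scal (fun u => f u ^ pred n) x (INR n)), is_derive_pow_comp, H|].
  ring.
Qed.

Lemma is_derive_Lf_a (a t : R) :
  Rabs a < 1 -> is_derive (fun u => Lf u t) a (Lf_a a t).
Proof.
  intros H; assert (Hq := qf_pos a t H).
  unfold Lf, Lf_a; unfold qf in *; auto_derive.
  - repeat split; lra.
  - field; lra.
Qed.

Lemma is_derive_Lf_aa (a t : R) :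
  Rabs a < 1 -> is_derive (fun u => Lf_a u t) a (Lf_aa a t).
Proof.
  intros H; assert (Hq := qf_pos a t H).
  unfold Lf_a, Lf_aa; unfold qf in *; auto_derive.
  - lra.
  - field; lra.
Qed.

Lemma is_derive_Lf_t (a t : R) :
  Rabs a < 1 -> is_derive (fun u => Lf a u) t (Lf_t a t).
Proof.
  intros H; assert (Hq := qf_pos a t H).
  unfold Lf, Lf_t; unfold qf in *; auto_derive.
  - repeat split; lra.
  - field; lra.
Qed.

Lemma is_derive_Lf_tt (a t : R) :
  Rabs a < 1 -> is_derive (fun u => Lf_t a u) t (Lf_tt a t).
Proof.
  intros H; assert (Hq := qf_pos a t H).
  unfold Lf_t, Lf_tt; unfold qf in *; auto_derive.
  - lra.
  - field; lra.
Qed.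

(** Laplace's equation in polar coordinates, multiplied by [a^2]: [Lf] is the real part of the
    holomorphic function [log (1 - z)] at [z = a e^{it}]. *)
Lemma Lf_harmonic (a t : R) :
  Rabs a < 1 -> a * Lf_a a t + a ^ 2 * Lf_aa a t + Lf_tt a t = 0.
Proof.
  intros H; assert (Hq := qf_pos a t H).
  assert (E := sin2_cos2 t); unfold Rsqr in E.
  unfold Lf_a, Lf_aa, Lf_tt; rewrite Rpow_mult_distr.
  replace (sin t ^ 2) with (1 - cos t ^ 2) by nra.
  unfold qf in *; field; lra.
Qed.

(** With [z = a e^{it}], the sum of squares is [|z / (1 - z)|^2 = a^2 / q]. The remaining term comes
    from [(1 - a^2) / q = 1 - 2 a Lf_a], which removes the denominator [q] and keeps the equation
    linear after integration. *)
Lemma Lf_gradient (a t : R) :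
  Rabs a < 1 ->
  (1 - a ^ 2) * (a ^ 2 * Lf_a a t ^ 2 + Lf_t a t ^ 2) + 2 * a ^ 3 * Lf_a a t = a ^ 2.
Proof.
  intros H; assert (Hq := qf_pos a t H).
  assert (E := sin2_cos2 t); unfold Rsqr in E.
  unfold Lf_a, Lf_t; unfold Rdiv at 2; rewrite !Rpow_mult_distr.
  replace (sin t ^ 2) with (1 - cos t ^ 2) by nra.
  unfold qf in *; field; lra.
Qed.

(** * Differentiation under the integral sign and joint continuity *)

Lemma continuity_2d_pt_continuous_r (f : R -> R -> R) (x y : R) :
  continuity_2d_pt f x y -> continuous (fun v => f x v) y.
Proof.
  intros H; apply continuity_pt_filterlim, continuity_pt_locally.
  intros eps; apply (locally_2d_1d_const_x _ _ _ (H eps)).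
Qed.

Lemma locally_Rabs_lt (x r : R) : Rabs x < r -> locally x (fun u => Rabs u < r).
Proof.
  intros H.
  apply (continuous_Rabs x (fun u => u < r)), (open_lt r _ H).
Qed.

Lemma is_derive_RInt_continuity_2d (f g : R -> R -> R) (a b r x : R) :
  (forall u t, Rabs u < r -> is_derive (fun z => f z t) u (g u t)) ->
  (forall u t, Rabs u < r -> continuity_2d_pt f u t) ->
  (forall u t, Rabs u < r -> continuity_2d_pt g u t) ->
  Rabs x < r ->
  is_derive (fun u => RInt (f u) a b) x (RInt (g x) a b).
Proof.
  intros Hd Hf Hg Hx.
  assert (Hloc := locally_Rabs_lt x r Hx).
  evar_last; [apply (is_derive_RInt_param f a b x)|].
  - apply (filter_imp (fun u => Rabs u < r)); [|exact Hloc].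
    intros u Hu t _; exists (g u t); apply Hd, Hu.
  (* The continuity required is that of [Derive], which is known to agree with [g] only where
     [|u| < r]; a neighbourhood of [x] suffices. *)
  - intros t _; apply (continuity_2d_pt_ext_loc g); [|apply Hg, Hx].
    destruct Hloc as [d Hloc]; exists d; intros u v Hu _.
    symmetry; apply is_derive_unique, Hd, Hloc, Hu.
  - apply (filter_imp (fun u => Rabs u < r)); [|exact Hloc].
    intros u Hu; apply (ex_RInt_continuous (V := R_CompleteNormedModule)).
    intros t _; apply continuity_2d_pt_continuous_r, Hf, Hu.
  - apply RInt_ext; intros t _; apply is_derive_unique, Hd, Hx.
Qed.

Lemma continuity_2d_pt_div (f g : R -> R -> R) (x y : R) :
  continuity_2d_pt f x y -> continuity_2d_pt g x y -> g x y <> 0 ->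
  continuity_2d_pt (fun u v => f u v / g u v) x y.
Proof.
  intros; apply continuity_2d_pt_mult; auto.
  apply continuity_2d_pt_inv; auto.
Qed.

Lemma continuity_2d_pt_pow (f : R -> R -> R) (n : nat) (x y : R) :
  continuity_2d_pt f x y -> continuity_2d_pt (fun u v => f u v ^ n) x y.
Proof.
  intros H; induction n as [|n IH]; simpl.
  - apply continuity_2d_pt_const.
  - apply continuity_2d_pt_mult; auto.
Qed.

Lemma continuity_2d_pt_cos (x y : R) : continuity_2d_pt (fun _ v => cos v) x y.
Proof.
  apply (continuity_1d_2d_pt_comp cos (fun _ v => v)).
  - apply continuity_cos.
  - apply continuity_2d_pt_id2.
Qed.

Ltac continuity_2d :=
  repeat first
    [ assumption
    | apply continuity_2d_pt_const
    | apply continuity_2d_pt_id1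
    | apply continuity_2d_pt_cos
    | apply continuity_2d_pt_minus
    | apply continuity_2d_pt_plus
    | apply continuity_2d_pt_div
    | apply continuity_2d_pt_mult
    | apply continuity_2d_pt_inv
    | apply continuity_2d_pt_pow ].

Lemma qf_continuity (a t : R) : continuity_2d_pt qf a t.
Proof. unfold qf; continuity_2d. Qed.

Lemma Lf_continuity (a t : R) : Rabs a < 1 -> continuity_2d_pt Lf a t.
Proof.
  intros H; unfold Lf.
  apply continuity_2d_pt_div; [|apply continuity_2d_pt_const|lra].
  apply continuity_1d_2d_pt_comp; [|apply qf_continuity].
  apply derivable_continuous_pt; exists (/ qf a t).
  apply derivable_pt_lim_ln, qf_pos, H.
Qed.

Lemma Lf_a_continuity (a t : R) : Rabs a < 1 -> continuity_2d_pt Lf_a a t.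
Proof.
  intros H; assert (Hq := qf_pos a t H); assert (Hc := qf_continuity a t).
  unfold Lf_a; continuity_2d; lra.
Qed.

Lemma Lf_aa_continuity (a t : R) : Rabs a < 1 -> continuity_2d_pt Lf_aa a t.
Proof.
  intros H; assert (Hq := qf_pos a t H); assert (Hc := qf_continuity a t).
  unfold Lf_aa; continuity_2d; try lra; apply pow_nonzero; lra.
Qed.

(** * Moments of the kernel and their differential equation *)

Definition Lpow (n : nat) (a t : R) : R := Lf a t ^ n.
Definition Lpow_a (n : nat) (a t : R) : R := pow_d1 n (Lf a t) * Lf_a a t.
Definition Lpow_aa (n : nat) (a t : R) : R :=
  pow_d2 n (Lf a t) * Lf_a a t ^ 2 + pow_d1 n (Lf a t) * Lf_aa a t.

Lemma Lpow_continuity (n : nat) (a t : R) :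
  Rabs a < 1 -> continuity_2d_pt (Lpow n) a t.
Proof. intros H; apply continuity_2d_pt_pow, Lf_continuity, H. Qed.

Lemma Lpow_a_continuity (n : nat) (a t : R) :
  Rabs a < 1 -> continuity_2d_pt (Lpow_a n) a t.
Proof.
  intros H.
  assert (H0 := Lf_continuity a t H); assert (H1 := Lf_a_continuity a t H).
  unfold Lpow_a, pow_d1; continuity_2d.
Qed.

Lemma Lpow_aa_continuity (n : nat) (a t : R) :
  Rabs a < 1 -> continuity_2d_pt (Lpow_aa n) a t.
Proof.
  intros H.
  assert (H0 := Lf_continuity a t H); assert (H1 := Lf_a_continuity a t H).
  assert (H2 := Lf_aa_continuity a t H).
  unfold Lpow_aa, pow_d2, pow_d1; continuity_2d.
Qed.

Lemma is_derive_Lpow_a (n : nat) (a t : R) :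
  Rabs a < 1 -> is_derive (fun u => Lpow n u t) a (Lpow_a n a t).
Proof. intros H; apply (is_derive_pow_comp n (fun u => Lf u t)), is_derive_Lf_a, H. Qed.

Lemma is_derive_Lpow_aa (n : nat) (a t : R) :
  Rabs a < 1 -> is_derive (fun u => Lpow_a n u t) a (Lpow_aa n a t).
Proof.
  intros H; unfold Lpow_a; evar_last.
  - apply (is_derive_mult (fun u => pow_d1 n (Lf u t)) (fun u => Lf_a u t)).
    + apply (is_derive_pow_d1_comp n (fun u => Lf u t)), is_derive_Lf_a, H.
    + apply is_derive_Lf_aa, H.
    + intros; apply Rmult_comm.
  - unfold Lpow_aa, plus, mult; simpl; ring.
Qed.

(** The function differentiated is itself the [t]-derivative of [Lf ^ n], so this second derivative
    integrates to a boundary term. *)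
Lemma is_derive_Lpow_tt (n : nat) (a t : R) :
  Rabs a < 1 ->
  is_derive (fun u => pow_d1 n (Lf a u) * Lf_t a u) t
    (pow_d2 n (Lf a t) * Lf_t a t ^ 2 + pow_d1 n (Lf a t) * Lf_tt a t).
Proof.
  intros H; evar_last.
  - apply (is_derive_mult (fun u => pow_d1 n (Lf a u)) (fun u => Lf_t a u)).
    + apply (is_derive_pow_d1_comp n (fun u => Lf a u)), is_derive_Lf_t, H.
    + apply is_derive_Lf_tt, H.
    + intros; apply Rmult_comm.
  - unfold plus, mult; simpl; ring.
Qed.

Definition moment (n : nat) (a : R) : R := RInt (Lpow n a) (- PI) PI.
Definition moment_a (n : nat) (a : R) : R := RInt (Lpow_a n a) (- PI) PI.
Definition moment_aa (n : nat) (a : R) : R := RInt (Lpow_aa n a) (- PI) PI.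

Lemma is_derive_moment (n : nat) (a : R) :
  Rabs a < 1 -> is_derive (moment n) a (moment_a n a).
Proof.
  apply is_derive_RInt_continuity_2d; intros;
    [apply is_derive_Lpow_a|apply Lpow_continuity|apply Lpow_a_continuity]; auto.
Qed.

Lemma is_derive_moment_a (n : nat) (a : R) :
  Rabs a < 1 -> is_derive (moment_a n) a (moment_aa n a).
Proof.
  apply is_derive_RInt_continuity_2d; intros;
    [apply is_derive_Lpow_aa|apply Lpow_a_continuity|apply Lpow_aa_continuity]; auto.
Qed.

Lemma moment_ode (n : nat) (a : R) :
  Rabs a < 1 ->
  (1 - a ^ 2) * (a * moment_a n a + a ^ 2 * moment_aa n a)
  + 2 * INR n * a ^ 3 * moment_a (pred n) a
  - a ^ 2 * INR n * INR (pred n) * moment (pred (pred n)) a = 0.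
Proof.
  intros H.
  assert (Hint : forall f, (forall t, continuity_2d_pt f a t) ->
    is_RInt (f a) (- PI) PI (RInt (f a) (- PI) PI)).
  { intros f Hf; apply (RInt_correct (V := R_CompleteNormedModule)).
    apply (ex_RInt_continuous (V := R_CompleteNormedModule)).
    intros t _; apply continuity_2d_pt_continuous_r, Hf. }
  (* The left-hand side before integration. Its integral is computed twice: as a boundary term
     ([HI]) and term by term ([HJ]). *)
  set (G := fun u t => (1 - a ^ 2) * (a * Lpow_a n u t + a ^ 2 * Lpow_aa n u t)
    + 2 * INR n * a ^ 3 * Lpow_a (pred n) u t
    - a ^ 2 * INR n * INR (pred n) * Lpow (pred (pred n)) u t).
  assert (HG : forall t, continuity_2d_pt G a t).
  { intros t; assert (H0 := Lpow_continuity (pred (pred n)) a t H).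
    assert (H1 := Lpow_a_continuity n a t H).
    assert (H1' := Lpow_a_continuity (pred n) a t H).
    assert (H2 := Lpow_aa_continuity n a t H).
    unfold G.
    apply continuity_2d_pt_minus; [apply continuity_2d_pt_plus|];
      (apply continuity_2d_pt_mult; [apply continuity_2d_pt_const|]); auto.
    apply continuity_2d_pt_plus;
      (apply continuity_2d_pt_mult; [apply continuity_2d_pt_const|]); auto. }
  assert (HI : is_RInt (G a) (- PI) PI
    (minus (- (1 - a ^ 2) * (pow_d1 n (Lf a PI) * Lf_t a PI))
       (- (1 - a ^ 2) * (pow_d1 n (Lf a (- PI)) * Lf_t a (- PI))))).
  { apply (is_RInt_derive (fun t => - (1 - a ^ 2) * (pow_d1 n (Lf a t) * Lf_t a t))).
    - intros t _; evar_last.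
      + apply is_derive_scal, is_derive_Lpow_tt, H.
      + assert (E1 := Lf_harmonic a t H); assert (E2 := Lf_gradient a t H).
        unfold G, Lpow, Lpow_a, Lpow_aa, pow_d2, pow_d1.
        revert E1 E2.
        (* What remains is polynomial: harmonicity eliminates [Ltt], and the gradient identity
           enters multiplied by [n (n - 1) L^(n - 2)]. *)
        generalize (Lf a t) (Lf_a a t) (Lf_aa a t) (Lf_t a t) (Lf_tt a t).
        intros L La Laa Lt Ltt E1 E2.
        replace Ltt with (- (a * La + a ^ 2 * Laa)) by lra.
        generalize (L ^ pred n) (L ^ pred (pred n)); intros P Q.
        apply (f_equal (Rmult (INR n * INR (pred n) * Q))) in E2.
        unfold scal; simpl; unfold mult; simpl.
        lra.
    - intros t _; apply continuity_2d_pt_continuous_r, HG. }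
  assert (HJ : is_RInt (G a) (- PI) PI
    ((1 - a ^ 2) * (a * moment_a n a + a ^ 2 * moment_aa n a)
    + 2 * INR n * a ^ 3 * moment_a (pred n) a
    - a ^ 2 * INR n * INR (pred n) * moment (pred (pred n)) a)).
  { unfold G; apply (is_RInt_minus (V := R_NormedModule));
      [apply (is_RInt_plus (V := R_NormedModule))|].
    - apply (is_RInt_scal (V := R_NormedModule)), (is_RInt_plus (V := R_NormedModule));
        apply (is_RInt_scal (V := R_NormedModule)), Hint; intros t;
        [apply Lpow_a_continuity|apply Lpow_aa_continuity]; auto.
    - apply (is_RInt_scal (V := R_NormedModule)), Hint; intros t.
      apply Lpow_a_continuity; auto.
    - apply (is_RInt_scal (V := R_NormedModule)), Hint; intros t.
      apply Lpow_continuity; auto. }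
  rewrite <- (is_RInt_unique _ _ _ _ HJ), (is_RInt_unique _ _ _ _ HI).
  (* Both boundary values vanish, because [Lf_t] carries the factor [sin t]. *)
  unfold Lf_t; rewrite sin_neg, sin_PI, Ropp_0.
  unfold minus, plus, opp; simpl; unfold Rdiv; ring.
Qed.

Lemma rho_moment (n : nat) (a : R) :
  Rabs a < 1 -> rho n a = / (2 * PI) * moment n a.
Proof.
  intros H; unfold rho, moment, Lpow; f_equal.
  apply RInt_ext; intros t _; now rewrite Re_log_Lf.
Qed.

(** * Uniqueness for the differential equation *)

(* The equation is [theta^2 F = 0], which forces [a F'(a)] to be constant. *)
Lemma euler_ode_zero (F F1 F2 : R -> R) (r : R) :
  (forall a, Rabs a < r -> is_derive F a (F1 a)) ->
  (forall a, Rabs a < r -> is_derive F1 a (F2 a)) ->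
  (forall a, Rabs a < r -> a * F1 a + a ^ 2 * F2 a = 0) ->
  F 0 = 0 ->
  forall a, Rabs a < r -> F a = 0.
Proof.
  intros H1 H2 Hode H0.
  assert (Hb : forall a x, Rmin 0 a <= x <= Rmax 0 a -> Rabs a < r -> Rabs x < r).
  { intros a x [Hl Hr] Ha; apply Rabs_def2 in Ha; apply Rabs_def1;
      unfold Rmin, Rmax in *; destruct (Rle_dec 0 a); lra. }
  (* The equation is singular at 0, but the mean value theorem asks for derivatives only strictly
     between 0 and [a], where division by [x] is allowed. At 0 itself continuity is enough. *)
  assert (Hn : forall a x, Rmin 0 a < x < Rmax 0 a -> x <> 0).
  { intros a x [Hl Hr]; unfold Rmin, Rmax in *; destruct (Rle_dec 0 a); lra. }
  assert (HT : forall a, Rabs a < r ->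
    is_derive (fun u => u * F1 u) a (F1 a + a * F2 a)).
  { intros a Ha; evar_last.
    - apply (is_derive_mult (fun u : R => u) F1);
        [apply is_derive_id|apply H2, Ha|intros; apply Rmult_comm].
    - unfold plus, mult, one; simpl; ring. }
  assert (HF1 : forall a, Rabs a < r -> a * F1 a = 0).
  { intros a Ha.
    destruct (MVT_gen (fun u => u * F1 u) 0 a (fun _ => 0)) as [c [_ Hc]].
    - intros x Hx; assert (Hx0 := Hn a x Hx).
      assert (Hxr : Rabs x < r) by (apply (Hb a); auto; lra).
      evar_last; [apply HT, Hxr|].
      apply (Rmult_eq_reg_l x); auto; rewrite Rmult_0_r, <- (Hode x Hxr); ring.
    - intros x Hx.
      apply continuity_pt_filterlim, (ex_derive_continuous (fun u => u * F1 u)).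
      exists (F1 x + x * F2 x); apply HT, (Hb a); auto.
    - lra. }
  intros a Ha.
  destruct (MVT_gen F 0 a (fun _ => 0)) as [c [_ Hc]].
  - intros x Hx; assert (Hx0 := Hn a x Hx).
    assert (Hxr : Rabs x < r) by (apply (Hb a); auto; lra).
    evar_last; [apply H1, Hxr|].
    apply (Rmult_eq_reg_l x); auto; rewrite (HF1 x Hxr), Rmult_0_r; reflexivity.
  - intros x Hx.
    apply continuity_pt_filterlim, (ex_derive_continuous F).
    exists (F1 x); apply H1, (Hb a); auto.
  - lra.
Qed.

(** * Growth of nested sums and convergence of polylogarithms *)

Lemma CV_radius_le_compat (a b : nat -> R) :
  (forall k, Rabs (a k) <= Rabs (b k)) -> Rbar_le (CV_radius b) (CV_radius a).
Proof.
  intros H; apply (proj2 (CV_radius_bounded b)).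
  intros r [M HM]; apply (proj1 (CV_radius_bounded a)).
  exists M; intros k; eapply Rle_trans; [|apply (HM k)].
  rewrite !Rabs_mult; apply Rmult_le_compat_r; auto using Rabs_pos.
Qed.

(** Starting from the geometric series, multiplying by [x] and differentiating multiplies the
    coefficient of index [k] by [k + 1] and preserves the radius. *)
Lemma CV_radius_INR_pow (p : nat) : CV_radius (fun k => INR (S k) ^ p) = 1.
Proof.
  induction p as [|p IH].
  - rewrite (CV_radius_finite_DAlembert _ 1).
    + now rewrite Rinv_1.
    + intros; simpl; lra.
    + lra.
    + eapply is_lim_seq_ext; [|apply is_lim_seq_const].
      intros k; simpl; unfold Rdiv; rewrite Rinv_1, Rmult_1_r, Rabs_R1; reflexivity.
  - rewrite <- IH, <- (CV_radius_incr_1 (fun k => INR (S k) ^ p)),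
      <- (CV_radius_derive (PS_incr_1 _)).
    apply CV_radius_ext; intros k; reflexivity.
Qed.

Lemma nested_sum_step (b : nat) (w : list nat) (k : nat) :
  nested_sum (b :: w) (S (S k)) =
  nested_sum (b :: w) (S k) + / INR (S k) ^ b * nested_sum w (S k).
Proof.
  change (sum_n_m (fun m => / INR m ^ b * nested_sum w m) 1 (S k) =
    sum_n_m (fun m => / INR m ^ b * nested_sum w m) 1 k
    + / INR (S k) ^ b * nested_sum w (S k)).
  rewrite sum_n_Sm by lia; reflexivity.
Qed.

Lemma nested_sum_cons_1 (b : nat) (w : list nat) : nested_sum (b :: w) 1 = 0.
Proof. simpl; rewrite sum_n_m_zero; auto. Qed.

Lemma inv_INR_pow_bounds (k b : nat) : 0 <= / INR (S k) ^ b <= 1.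
Proof.
  assert (1 <= INR (S k)) by (rewrite S_INR; generalize (pos_INR k); lra).
  assert (1 <= INR (S k) ^ b) by (apply pow_R1_Rle; auto).
  split.
  - left; apply Rinv_0_lt_compat; lra.
  - rewrite <- Rinv_1; apply Rinv_le_contravar; lra.
Qed.

(** A crude bound suffices: polynomial growth already gives radius at least 1. With [N = k + 1] and
    [d] the length of [w], the inner induction uses [N^(d+1) + N^d = (N + 1) N^d <= (N +
    1)^(d+1)]. *)
Lemma nested_sum_bounds (w : list nat) (k : nat) :
  0 <= nested_sum w (S k) <= INR (S k) ^ length w.
Proof.
  revert k; induction w as [|b w IHw]; intros k.
  - simpl; lra.
  - induction k as [|k IHk].
    + rewrite nested_sum_cons_1; rewrite pow1; lra.
    + rewrite nested_sum_step; simpl length.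
      assert (Hi := inv_INR_pow_bounds k b); assert (Hw := IHw k).
      assert (0 < INR (S k)) by (apply lt_0_INR; lia).
      assert (Hm : INR (S k) ^ length w <= INR (S (S k)) ^ length w).
      { apply pow_incr; rewrite (S_INR (S k)); lra. }
      simpl length in IHk; rewrite <- !tech_pow_Rmult in *.
      rewrite (S_INR (S k)) in *.
      split; nra.
Qed.

(** The index is shifted: this is the coefficient of [z^(k+1)] in [Li w z]. Hence it is 0 for the
    empty tuple, whose value 1 is only a constant term. *)
Definition Li_coef (w : list nat) (k : nat) : R :=
  match w with
  | nil => 0
  | (a :: w')%list => / INR (S k) ^ a * nested_sum w' (S k)
  end.

Lemma Li_PSeries (a : nat) (w : list nat) (z : R) :
  Li (a :: w) z = z * PSeries (Li_coef (a :: w)) z.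
Proof.
  unfold Li, PSeries; rewrite <- Series_scal_l; apply Series_ext; intros k.
  unfold Li_coef, Rdiv; rewrite <- tech_pow_Rmult; ring.
Qed.

Lemma CV_radius_Li_coef (w : list nat) : Rbar_le 1 (CV_radius (Li_coef w)).
Proof.
  rewrite <- (CV_radius_INR_pow (length w)).
  apply CV_radius_le_compat; intros k.
  assert (0 < INR (S k)) by (apply lt_0_INR; lia).
  destruct w as [|a w].
  - unfold Li_coef; rewrite Rabs_R0; apply Rabs_pos.
  - assert (Hi := inv_INR_pow_bounds k a); assert (Hw := nested_sum_bounds w k).
    assert (1 <= INR (S k)) by (rewrite S_INR; generalize (pos_INR k); lra).
    simpl length; unfold Li_coef; rewrite <- tech_pow_Rmult.
    rewrite !Rabs_pos_eq by nra.
    nra.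
Qed.

(** * Finite sums over words and their power series *)

Lemma sum_over_cons (w : list nat) (l : list (list nat)) (f : list nat -> R) :
  sum_over (w :: l) f = f w + sum_over l f.
Proof. reflexivity. Qed.

Lemma sum_over_app (l l' : list (list nat)) (f : list nat -> R) :
  sum_over (l ++ l') f = sum_over l f + sum_over l' f.
Proof.
  induction l as [|w l IH]; [unfold sum_over; simpl; ring|].
  rewrite <- app_comm_cons, !sum_over_cons, IH; ring.
Qed.

Lemma sum_over_ext (l : list (list nat)) (f g : list nat -> R) :
  (forall w, In w l -> f w = g w) -> sum_over l f = sum_over l g.
Proof. intros H; unfold sum_over; now rewrite (map_ext_in _ _ _ H). Qed.

Lemma sum_over_scal (l : list (list nat)) (c : R) (f : list nat -> R) :
  sum_over l (fun w => c * f w) = c * sum_over l f.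
Proof.
  induction l as [|w l IH]; [unfold sum_over; simpl; ring|].
  rewrite !sum_over_cons, IH; ring.
Qed.

Lemma sum_over_map (h : list nat -> list nat) (l : list (list nat)) (f : list nat -> R) :
  sum_over (map h l) f = sum_over l (fun w => f (h w)).
Proof. unfold sum_over; now rewrite map_map. Qed.

Lemma CV_radius_sum_over (l : list (list nat)) :
  Rbar_le 1 (CV_radius (fun k => sum_over l (fun w => 4 ^ length w * Li_coef w k))).
Proof.
  induction l as [|w l IH].
  - unfold sum_over; simpl; rewrite CV_radius_const_0; exact I.
  - eapply Rbar_le_trans;
      [|apply (CV_radius_plus (PS_scal (4 ^ length w) (Li_coef w))
           (fun k => sum_over l (fun w => 4 ^ length w * Li_coef w k)))].
    apply Rbar_min_case; auto.
    rewrite CV_radius_scal by (apply pow_nonzero; lra).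
    apply CV_radius_Li_coef.
Qed.

Lemma ex_pseries_radius_1 (a : nat -> R) (y : R) :
  Rbar_le 1 (CV_radius a) -> Rabs y < 1 -> ex_pseries a y.
Proof.
  intros Ha Hy; apply CV_radius_inside; eapply Rbar_lt_le_trans; [|exact Ha]; exact Hy.
Qed.

Lemma PSeries_sum_over (l : list (list nat)) (y : R) :
  Rabs y < 1 ->
  PSeries (fun k => sum_over l (fun w => 4 ^ length w * Li_coef w k)) y =
  sum_over l (fun w => 4 ^ length w * PSeries (Li_coef w) y).
Proof.
  intros Hy; induction l as [|w l IH].
  - unfold sum_over; simpl; apply PSeries_const_0.
  - rewrite sum_over_cons, <- IH, <- PSeries_scal.
    apply (PSeries_plus (PS_scal (4 ^ length w) (Li_coef w))
      (fun k => sum_over l (fun w => 4 ^ length w * Li_coef w k))).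
    + apply ex_pseries_radius_1; auto.
      rewrite CV_radius_scal by (apply pow_nonzero; lra); apply CV_radius_Li_coef.
    + apply ex_pseries_radius_1; auto; apply CV_radius_sum_over.
Qed.

(** * Coefficients of the right-hand side and their recurrence *)

Definition prefactor (n : nat) : R := (-1) ^ n * INR (fact n) / 4 ^ n.

Lemma prefactor_S (n : nat) : prefactor (S n) = - INR (S n) / 4 * prefactor n.
Proof.
  unfold prefactor; rewrite fact_simpl, mult_INR; simpl pow.
  field; apply pow_nonzero; lra.
Qed.

Lemma prefactor_neq_0 (n : nat) : prefactor n <> 0.
Proof.
  unfold prefactor, Rdiv; repeat apply Rmult_integral_contrapositive_currified.
  - apply pow_nonzero; lra.
  - apply INR_fact_neq_0.
  - apply Rinv_neq_0_compat, pow_nonzero; lra.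
Qed.

(* Junk indices are harmless: [indices 0 = indices 1 = []], so that
   [rho_coef 0] and [rho_coef 1] represent the constants [1] and [0]. *)
Definition rho_coef (n k : nat) : R :=
  match k with
  | O => 0 ^ n
  | S k' => prefactor n * sum_over (indices n) (fun w => 4 ^ length w * Li_coef w k')
  end.

(** Removing the leading 2 from an admissible word of weight [m + 2] leaves an arbitrary word of
    weight [m] in the letters 1 and 2; this is the resulting inner sum. *)
Definition words_sum (m k : nat) : R :=
  sum_over (words12 m) (fun w => 4 ^ length w * nested_sum w k).

Lemma rho_coef_words_sum (m k : nat) :
  rho_coef (S (S m)) (S k) =
  prefactor (S (S m)) * (4 * / INR (S k) ^ 2 * words_sum m (S k)).
Proof.
  unfold rho_coef, words_sum; f_equal.
  unfold indices; rewrite sum_over_map, <- sum_over_scal.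
  apply sum_over_ext; intros w _; unfold Li_coef; simpl length.
  rewrite <- tech_pow_Rmult; ring.
Qed.

Lemma words_sum_0 (k : nat) : words_sum 0 k = 1.
Proof. unfold words_sum, sum_over; simpl; ring. Qed.

(** A word of positive weight has a first letter, and its outermost index would have to be positive
    and less than 1. *)
Lemma words_sum_S_1 (m : nat) : words_sum (S m) 1 = 0.
Proof.
  assert (H : forall b l,
    sum_over (map (cons b) l) (fun w => 4 ^ length w * nested_sum w 1) = 0).
  { intros b l; rewrite sum_over_map.
    induction l as [|w l IH]; [reflexivity|].
    rewrite sum_over_cons, IH, nested_sum_cons_1; ring. }
  unfold words_sum; destruct m as [|m].
  - apply (H 1%nat (words12 0)).
  - change (words12 (S (S m))) with
      (map (cons 1%nat) (words12 (S m)) ++ map (cons 2%nat) (words12 m))%list.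
    rewrite sum_over_app, !H; ring.
Qed.

Lemma sum_over_cons_step (b : nat) (l : list (list nat)) (k : nat) :
  sum_over (map (cons b) l) (fun w => 4 ^ length w * nested_sum w (S (S k))) =
  sum_over (map (cons b) l) (fun w => 4 ^ length w * nested_sum w (S k))
  + 4 * / INR (S k) ^ b * sum_over l (fun w => 4 ^ length w * nested_sum w (S k)).
Proof.
  rewrite !sum_over_map.
  induction l as [|w l IH]; [unfold sum_over; simpl; ring|].
  rewrite !sum_over_cons, IH, nested_sum_step; simpl length.
  rewrite <- tech_pow_Rmult; ring.
Qed.

Lemma words_sum_1_step (k : nat) :
  words_sum 1 (S (S k)) = words_sum 1 (S k) + 4 * / INR (S k) * words_sum 0 (S k).
Proof.
  rewrite <- (pow_1 (INR (S k))); apply (sum_over_cons_step 1 (words12 0)).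
Qed.

(** Raising the cutoff adds exactly the terms whose outermost index is [k + 1]. They are sorted by
    the first letter, whose removal lowers the weight by 1 or 2 and the length by one, hence the
    factors 4. *)
Lemma words_sum_SS_step (m k : nat) :
  words_sum (S (S m)) (S (S k)) =
  words_sum (S (S m)) (S k) + 4 * / INR (S k) * words_sum (S m) (S k)
  + 4 * / INR (S k) ^ 2 * words_sum m (S k).
Proof.
  unfold words_sum.
  change (words12 (S (S m))) with
    (map (cons 1%nat) (words12 (S m)) ++ map (cons 2%nat) (words12 m))%list.
  rewrite !sum_over_app, !sum_over_cons_step, pow_1; ring.
Qed.

(** The factor [(k + 1)^2] cancels the denominator of the leading 2, and the remaining sum over
    words is split by its first letter: 1 leads to [n - 1], 2 to [n - 2]. The ratios of prefactors
    turn the factors 4 into [- n] and [n (n - 1) / 4]. *)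
Lemma rho_coef_rec (n k : nat) :
  INR (S k) ^ 2 * rho_coef n (S k) =
  INR k ^ 2 * rho_coef n k - INR n * (INR k * rho_coef (pred n) k)
  + INR n * INR (pred n) / 4 * rho_coef (pred (pred n)) k.
Proof.
  assert (Hlow : forall m j, (m <= 1)%nat -> rho_coef m (S j) = 0).
  { intros [|[|m]] j Hm; try lia; unfold rho_coef, sum_over; simpl; ring. }
  destruct n as [|[|m]].
  - rewrite Hlow by lia; destruct k; [simpl; field|].
    simpl pred; rewrite Hlow by lia; simpl INR; field.
  - rewrite Hlow by lia; destruct k; [simpl; field|].
    simpl pred; rewrite !Hlow by lia; simpl (INR 0); field.
  - rewrite rho_coef_words_sum; simpl pred.
    assert (Hk : INR (S k) <> 0) by (apply not_0_INR; lia).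
    destruct k as [|k].
    (* For [k = 0] the right-hand side is nonzero only if [n = 2], through the constant coefficient
       1 of [rho_coef 0]. *)
    + simpl (INR 0); simpl (INR 1); unfold rho_coef.
      destruct m as [|m].
      * rewrite words_sum_0; unfold prefactor; simpl; field.
      * rewrite words_sum_S_1; simpl pow; field.
    + assert (Hk' : INR (S k) <> 0) by (apply not_0_INR; lia).
      rewrite rho_coef_words_sum, (prefactor_S (S m)), (prefactor_S m).
      (* For [n = 2] no word remains to be split, and for [n = 3] only the letter 1 can be removed;
         the missing terms match the vanishing coefficients in [Hlow]. *)
      destruct m as [|[|m]].
      * rewrite !Hlow by lia; rewrite !words_sum_0; field; auto.
      * rewrite (Hlow 1%nat) by lia.
        rewrite rho_coef_words_sum, words_sum_1_step, (prefactor_S 1); field; auto.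
      * rewrite !rho_coef_words_sum, words_sum_SS_step, !prefactor_S; field; auto.
Qed.

Lemma CV_radius_rho_coef (n : nat) : Rbar_le 1 (CV_radius (rho_coef n)).
Proof.
  rewrite <- CV_radius_decr_1.
  rewrite (CV_radius_ext _ (PS_scal (prefactor n)
    (fun k => sum_over (indices n) (fun w => 4 ^ length w * Li_coef w k))))
    by reflexivity.
  rewrite CV_radius_scal by apply prefactor_neq_0.
  apply CV_radius_sum_over.
Qed.

Lemma PSeries_rho_coef (n : nat) (y : R) :
  (2 <= n)%nat -> Rabs y < 1 ->
  PSeries (rho_coef n) y =
  prefactor n * sum_over (indices n) (fun w => 4 ^ length w * Li w y).
Proof.
  intros Hn Hy.
  (* The constant term split off here is [0 ^ n], which vanishes as [n >= 2]. *)
  rewrite PSeries_decr_1 by (apply ex_pseries_radius_1; auto using CV_radius_rho_coef).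
  rewrite (PSeries_ext _ (PS_scal (prefactor n)
    (fun k => sum_over (indices n) (fun w => 4 ^ length w * Li_coef w k))))
    by reflexivity.
  rewrite PSeries_scal, PSeries_sum_over by auto.
  destruct n as [|[|m]]; try lia.
  rewrite (sum_over_ext _ (fun w => 4 ^ length w * Li w y)
    (fun w => y * (4 ^ length w * PSeries (Li_coef w) y))).
  - rewrite sum_over_scal; simpl rho_coef; ring.
  - intros w Hw; apply In_indices in Hw as [w' [-> _]].
    rewrite Li_PSeries; ring.
Qed.

(** * The differential equation of the power series, in [y = a^2] *)

Definition gen (n : nat) (y : R) : R := PSeries (rho_coef n) y.
Definition gen1 (n : nat) (y : R) : R := PSeries (PS_derive (rho_coef n)) y.
Definition gen2 (n : nat) (y : R) : R := PSeries (PS_derive (PS_derive (rho_coef n))) y.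

Lemma is_derive_PSeries_sqr (c : nat -> R) (a : R) :
  Rbar_le 1 (CV_radius c) -> Rabs a < 1 ->
  is_derive (fun u => PSeries c (u ^ 2)) a (2 * a * PSeries (PS_derive c) (a ^ 2)).
Proof.
  intros Hc Ha.
  assert (Rabs (a ^ 2) < 1).
  { rewrite <- RPow_abs; generalize (Rabs_pos a); nra. }
  evar_last.
  - apply (is_derive_comp (PSeries c) (fun u => u ^ 2)).
    + apply is_derive_PSeries; eapply Rbar_lt_le_trans; [|exact Hc]; auto.
    + apply (is_derive_pow (fun u : R => u) 2 a 1), (is_derive_id (K := R_AbsRing)).
  - unfold scal; simpl; unfold mult; simpl; ring.
Qed.

(** This is [rho_coef_rec] multiplied by [y^k] and summed over [k]. *)
Lemma gen_ode (n : nat) (y : R) :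
  Rabs y < 1 ->
  gen1 n y + y * gen2 n y =
  y * (gen1 n y + y * gen2 n y) - INR n * (y * gen1 (pred n) y)
  + INR n * INR (pred n) / 4 * gen (pred (pred n)) y.
Proof.
  intros Hy.
  assert (HR := CV_radius_rho_coef).
  assert (HR1 : forall m, Rbar_le 1 (CV_radius (PS_derive (rho_coef m)))).
  { intros m; rewrite CV_radius_derive; auto. }
  (* The series of [(y gen')'], with coefficients [(k + 1)^2 c_(k+1)]. Multiplied by [y] it has
     coefficients [k^2 c_k], so [h] occurs on both sides of the recurrence. *)
  set (h := PS_plus (PS_derive (rho_coef n))
    (PS_incr_1 (PS_derive (PS_derive (rho_coef n))))).
  assert (Eh : forall k, h k = INR (S k) ^ 2 * rho_coef n (S k)).
  { intros k; unfold h, PS_plus, PS_incr_1, PS_derive, plus, zero; simpl plus.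
    destruct k as [|k]; [simpl; ring|].
    rewrite (S_INR (S k)); simpl; ring. }
  assert (X1 : ex_pseries (PS_derive (rho_coef n)) y)
    by (apply ex_pseries_radius_1; auto).
  assert (X2 : ex_pseries (PS_incr_1 (PS_derive (PS_derive (rho_coef n)))) y).
  { apply ex_pseries_radius_1; auto; rewrite CV_radius_incr_1, CV_radius_derive; auto. }
  assert (Xh : ex_pseries h y) by (apply ex_pseries_plus; auto).
  assert (Hh : PSeries h y = gen1 n y + y * gen2 n y).
  { unfold h; rewrite PSeries_plus, PSeries_incr_1 by auto; reflexivity. }
  assert (X3 : ex_pseries (PS_scal (- INR n) (PS_incr_1 (PS_derive (rho_coef (pred n))))) y).
  { apply ex_pseries_scal; [apply Rmult_comm|].
    apply ex_pseries_radius_1; auto; rewrite CV_radius_incr_1; auto. }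
  assert (X4 : ex_pseries (PS_scal (INR n * INR (pred n) / 4) (rho_coef (pred (pred n)))) y).
  { apply ex_pseries_scal; [apply Rmult_comm|]; apply ex_pseries_radius_1; auto. }
  assert (X5 := ex_pseries_incr_1 h y Xh).
  rewrite <- Hh at 1.
  rewrite (PSeries_ext h (PS_plus (PS_plus (PS_incr_1 h)
      (PS_scal (- INR n) (PS_incr_1 (PS_derive (rho_coef (pred n))))))
      (PS_scal (INR n * INR (pred n) / 4) (rho_coef (pred (pred n)))))).
  - rewrite !PSeries_plus, !PSeries_scal, !PSeries_incr_1, Hh;
      auto; [unfold gen, gen1; ring|].
    apply ex_pseries_plus; auto.
  - intros k; rewrite Eh, rho_coef_rec.
    unfold PS_plus, PS_scal, PS_incr_1, PS_derive, plus, scal, zero; simpl.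
    unfold mult; simpl.
    destruct k as [|k]; [simpl; ring|].
    rewrite Eh; simpl; ring.
Qed.

(** * Comparison of the two sides *)

Lemma moment_0 (n : nat) : moment n 0 = 2 * PI * 0 ^ n.
Proof.
  unfold moment; rewrite (RInt_ext _ (fun _ => 0 ^ n)).
  - rewrite RInt_const; unfold scal; simpl; unfold mult; simpl; ring.
  - intros t _; unfold Lpow, Lf, qf; f_equal.
    replace (1 - 2 * 0 * cos t + 0 ^ 2) with 1 by ring; rewrite ln_1; field.
Qed.

(** By strong induction the lower-order terms of [moment_ode] and [gen_ode] agree, so the difference
    of the two sides solves the homogeneous equation of [euler_ode_zero]. *)
Lemma moment_gen (n : nat) (a : R) :
  Rabs a < 1 -> / (2 * PI) * moment n a = gen n (a ^ 2).
Proof.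
  revert a; induction n as [n IH] using (well_founded_induction Nat.lt_wf_0).
  assert (Hpi := PI_RGT_0).
  assert (Hgen : forall m a, Rabs a < 1 ->
    is_derive (fun u => gen m (u ^ 2)) a (2 * a * gen1 m (a ^ 2))).
  { intros m a Ha; apply is_derive_PSeries_sqr; auto using CV_radius_rho_coef. }
  assert (IH0 : forall m a, (m < n)%nat -> Rabs a < 1 ->
    moment m a = 2 * PI * gen m (a ^ 2)).
  { intros m a Hm Ha; rewrite <- IH by auto; field; lra. }
  (* The functions agree on a neighbourhood of [a], so their derivatives agree too. *)
  assert (IH1 : forall m a, (m < n)%nat -> Rabs a < 1 ->
    moment_a m a = 2 * PI * (2 * a * gen1 m (a ^ 2))).
  { intros m a Hm Ha.
    rewrite <- (is_derive_unique _ _ _ (is_derive_moment m a Ha)).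
    apply is_derive_unique.
    apply (is_derive_ext_loc (fun u => 2 * PI * gen m (u ^ 2))).
    - apply (filter_imp (fun u => Rabs u < 1)); [|apply locally_Rabs_lt, Ha].
      intros u Hu; symmetry; apply IH0; auto.
    - apply is_derive_scal, Hgen, Ha. }
  intros a Ha; apply Rminus_diag_uniq; revert a Ha.
  apply (euler_ode_zero
    (fun a => / (2 * PI) * moment n a - gen n (a ^ 2))
    (fun a => / (2 * PI) * moment_a n a - 2 * a * gen1 n (a ^ 2))
    (fun a => / (2 * PI) * moment_aa n a
       - (2 * gen1 n (a ^ 2) + 4 * a ^ 2 * gen2 n (a ^ 2)))).
  - intros a Ha; apply (is_derive_minus (V := R_NormedModule)).
    + apply is_derive_scal, is_derive_moment, Ha.
    + apply Hgen, Ha.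
  - intros a Ha; apply (is_derive_minus (V := R_NormedModule)).
    + apply is_derive_scal, is_derive_moment_a, Ha.
    + evar_last.
      * apply (is_derive_mult (fun u => 2 * u) (fun u => gen1 n (u ^ 2))).
        -- apply is_derive_scal, (is_derive_id (K := R_AbsRing)).
        -- apply is_derive_PSeries_sqr; auto.
           rewrite CV_radius_derive; apply CV_radius_rho_coef.
        -- intros; apply Rmult_comm.
      * unfold plus, mult, one, gen1, gen2; simpl; ring.
  - intros a Ha.
    assert (Ha2 : a ^ 2 < 1) by (apply Rabs_def2 in Ha; nra).
    assert (Hy : Rabs (a ^ 2) < 1) by (rewrite Rabs_pos_eq; auto using pow2_ge_0).
    assert (E1 := moment_ode n a Ha).
    assert (E2 := gen_ode n (a ^ 2) Hy).
    (* The factor [INR n] is kept because for [n = 0] the index [pred n] is not smaller than [n],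
       and the induction hypothesis does not apply. *)
    assert (R1 : INR n * moment_a (pred n) a =
      INR n * (2 * PI * (2 * a * gen1 (pred n) (a ^ 2)))).
    { destruct n as [|m]; [simpl; ring|]; rewrite IH1; auto; lia. }
    assert (R2 : INR n * INR (pred n) * moment (pred (pred n)) a =
      INR n * INR (pred n) * (2 * PI * gen (pred (pred n)) (a ^ 2))).
    { destruct n as [|m]; [simpl; ring|]; rewrite IH0; auto; lia. }
    (* This nonzero factor brings in the leading coefficient [1 - a^2] of both equations. The
       [4 * a ^ 2] below arises since [a d/da = 2 y d/dy] for [y = a^2]. *)
    apply (Rmult_eq_reg_l (2 * PI * (1 - a ^ 2))); [|nra].
    rewrite Rmult_0_r.
    replace (2 * PI * (1 - a ^ 2) * _) with
      ((1 - a ^ 2) * (a * moment_a n a + a ^ 2 * moment_aa n a)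
       - 2 * PI * (4 * a ^ 2) * ((1 - a ^ 2) * (gen1 n (a ^ 2) + a ^ 2 * gen2 n (a ^ 2))))
      by (field; lra).
    replace ((1 - a ^ 2) * (a * moment_a n a + a ^ 2 * moment_aa n a)) with
      (a ^ 2 * (INR n * INR (pred n) * moment (pred (pred n)) a)
       - 2 * a ^ 3 * (INR n * moment_a (pred n) a)) by lra.
    replace ((1 - a ^ 2) * (gen1 n (a ^ 2) + a ^ 2 * gen2 n (a ^ 2))) with
      (- (INR n * (a ^ 2 * gen1 (pred n) (a ^ 2)))
       + INR n * INR (pred n) / 4 * gen (pred (pred n)) (a ^ 2)) by lra.
    rewrite R1, R2; field.
  - rewrite moment_0; unfold gen.
    replace (0 ^ 2) with 0 by ring; rewrite PSeries_0; simpl rho_coef; field; lra.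
Qed.

Theorem theorem8 (alpha : R) (n : nat) (halpha : Rabs alpha < 1) (hn : (2 <= n)%nat) :
  rho n alpha =
  (-1) ^ n * INR (fact n) / 4 ^ n *
  sum_over (indices n) (fun w => 4 ^ length w * Li w (alpha ^ 2)).
Proof.
  rewrite rho_moment, moment_gen by auto.
  apply PSeries_rho_coef; auto.
  rewrite <- RPow_abs; generalize (Rabs_pos alpha); nra.
Qed.
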